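(* Let $n\ge 3$ and let $W=\mathop{\wr}\limits_{i=1}^{\infty}S_n$. The maximal normal subgroups of $W$ are $$\widetilde W^{k}=S_n\wr S_n\wr\dots\wr S_n\wr\!\wr\,\widetilde A_{n^k}\wr S_n\wr S_n\wr\cdots\qquad(k\ge 2),$$ and, for $k=1$, $\widetilde W^{1}=A_n\wr\Big(\mathop{\wr}\limits_{i=2}^{\infty}S_n\Big)$.
   Context: $W$ is the infinite iterated permutational wreath product (the inverse limit of the finite iterated wreath products $W_k=\wr_{i=1}^k S_n$ under the natural projections $W_{k+1}\to W_k$); it is the automorphism group of the infinite $n$-regular rooted tree. An element is given by one permutation in $S_n$ at every vertex of the tree. The decrement of $\rho\in S_n$ is $dec(\rho)=n-(\text{number of cycles of }\rho)$. For $k\ge2$, $\widetilde W^{k}$ is the subgroup of all elements of $W$ for which the sum of the decrements of the permutations at the level of the tree corresponding to the $k$-th factor is even, with no condition on the other levels ($\widetilde A_{n^k}$ denotes the subdirect product of copies of $S_n$ cut out by this even-sum condition). $\widetilde W^{1}$ is the subgroup of elements whose root permutation lies in $A_n$.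
   Formalization: The list is not exhaustive as stated (the elements with even total decrement over the first two levels form another maximal normal subgroup), so exhaustiveness is claimed only for subgroups defined by separate conditions on each level; each listed subgroup is maximal among all normal subgroups. *)

(* Defs.v *)
From HB Require Import structures.
From mathcomp Require Import all_boot all_fingroup all_solvable.
From mathcomp Require Import boolp classical_sets.

Set Implicit Arguments.
Unset Strict Implicit.
Unset Printing Implicit Defensive.

Import GroupScope.
Local Open Scope group_scope.
Local Open Scope classical_set_scope.

(* A vertex of the n-regular rooted tree is the word read along the path from
   the root; the level of a vertex is the length of the word.  An element of
   the infinite wreath product is given by its vertex permutations.           *)
Definition W (n : nat) := seq 'I_n -> 'S_n.

HB.instance Definition _ (n : nat) := gen_eqMixin (W n).
HB.instance Definition _ (n : nat) := gen_choiceMixin (W n).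

Section Group.
Variable n : nat.
Implicit Types (g h : W n) (v : seq 'I_n).

Fixpoint tree_act g v : seq 'I_n :=
  if v is i :: s then g [::] i :: tree_act (fun u => g (i :: u)) s else [::].

Fixpoint tree_actV g v : seq 'I_n :=
  if v is i :: s then
    let j := (g [::])^-1 i in j :: tree_actV (fun u => g (j :: u)) s
  else [::].

(* Permutations compose from left to right, as in 'S_n: the product acts on the
   tree by g first, then h (see tree_act_mul).  Inductively this is the product
   (a ; b_1, ..., b_n) (c ; d_1, ..., d_n) = (a c ; b_i d_(i a)) of S_n wr W. *)
Definition W_mul g h : W n := fun v => g v * h (tree_act g v).
Definition W_one : W n := fun=> 1.
Definition W_inv g : W n := fun v => (g (tree_actV g v))^-1.

Lemma tree_act_one v : tree_act W_one v = v.
Proof. by elim: v => //= i s IHs; rewrite perm1 -[RHS]/(i :: s) -{2}IHs. Qed.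

Lemma tree_act_mul g h v : tree_act (W_mul g h) v = tree_act h (tree_act g v).
Proof.
elim: v g h => //= i s IHs g h; congr (_ :: _); first by rewrite /W_mul permM.
by rewrite -IHs.
Qed.

Lemma tree_actVK g v : tree_act g (tree_actV g v) = v.
Proof. by elim: v g => //= i s IHs g; rewrite permKV IHs. Qed.

Lemma tree_actK g v : tree_actV g (tree_act g v) = v.
Proof. by elim: v g => //= i s IHs g; rewrite permK IHs. Qed.

Lemma W_mulA : associative W_mul.
Proof.
move=> g h k; apply/funext => v; rewrite /W_mul -/(W_mul g h).
by rewrite tree_act_mul mulgA.
Qed.

Lemma W_mul1 : left_id W_one W_mul.
Proof. by move=> g; apply/funext => v; rewrite /W_mul mul1g tree_act_one. Qed.

Lemma W_mulr1 : right_id W_one W_mul.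
Proof. by move=> g; apply/funext => v; rewrite /W_mul mulg1. Qed.

Lemma W_mulV : left_inverse W_one W_inv W_mul.
Proof.
move=> g; apply/funext => v; rewrite /W_mul /W_inv.
have -> : tree_act (fun v => (g (tree_actV g v))^-1) v = tree_actV g v.
  by elim: v g => //= i s IHs g; rewrite -IHs.
by rewrite mulVg.
Qed.

Lemma W_mulrV : right_inverse W_one W_inv W_mul.
Proof.
by move=> g; apply/funext => v; rewrite /W_mul /W_inv tree_actK mulgV.
Qed.

HB.instance Definition _ :=
  isGroup.Build (W n) W_mulA W_mul1 W_mulr1 W_mulV W_mulrV.

Lemma tree_act_rcons g v i : tree_act g (rcons v i) = rcons (tree_act g v) (g v i).
Proof. by elim: v g => //= j s IHs g; rewrite IHs. Qed.

(* W is the automorphism group of the rooted tree. *)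
Lemma tree_act_aut (f : seq 'I_n -> seq 'I_n) :
  (bijective f /\ f [::] = [::] /\
   forall v i, exists j, f (rcons v i) = rcons (f v) j) <->
  (exists! g : W n, tree_act g = f).
Proof.
split=> [[/bij_inj fI [f0 fS]]|[g [<- _]]]; last first.
  split; first by exists (tree_actV g); [apply: tree_actK | apply: tree_actVK].
  by split=> // v i; exists (g v i); rewrite tree_act_rcons.
have [p fE] : exists p : seq 'I_n -> 'I_n -> 'I_n,
    forall v i, f (rcons v i) = rcons (f v) (p v i).
  by exists (fun v i => sval (cid (fS v i))) => v i; exact: (svalP (cid (fS v i))).
have pI v : injective (p v).
  by move=> i j eqp; apply: (@rcons_injr _ v); apply: fI; rewrite !fE eqp.
exists (fun v => perm (@pI v)); split.
  apply/funext; elim/last_ind => //= v i IHv.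
  by rewrite tree_act_rcons IHv permE fE.
move=> g eqf; apply/funext => v; apply/permP => i.
by rewrite permE; apply: (@rcons_injr _ (f v)); rewrite -fE -eqf tree_act_rcons.
Qed.

End Group.

Definition normal_subgroup (G : groupType) (N : set G) : Prop :=
  [/\ N 1, forall x y, N x -> N y -> N (x * y), forall x, N x -> N x^-1
    & forall x y, N x -> N (x ^ y)].

Definition maximal_normal_subgroup (G : groupType) (N : set G) : Prop :=
  [/\ normal_subgroup N, N <> [set: G]
    & forall M : set G, normal_subgroup M -> N `<=` M ->
        M = N \/ M = [set: G]].

Definition dec (n : nat) (s : 'S_n) : nat := n - #|porbits s|.

(* The k-th factor of the wreath product acts at the n ^ (k - 1) vertices of
   level k - 1, the first factor being at the root.                           *)
Definition W_tilde (n k : nat) : set (W n) :=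
  [set g | ~~ odd (\sum_(v : k.-1.-tuple 'I_n) dec (g v))].

Definition W_tilde1 (n : nat) : set (W n) :=
  [set g | g [::] \in 'Alt_('I_n)].

Definition level (n m : nat) (g : W n) : {ffun m.-tuple 'I_n -> 'S_n} :=
  [ffun v : m.-tuple 'I_n => g v].

(* N is a product G_1 wr G_2 wr ... of level factors: the permutations at each
   level range over a prescribed set (such as a subdirect product of copies of
   S_n), with no condition linking different levels.  Without this restriction
   there are other maximal normal subgroups, for instance the kernel of
   g |-> sgn (g [::]) * \prod_i sgn (g [:: i]).                              *)
Definition levelwise (n : nat) (N : set (W n)) : Prop :=
  exists H : forall m, set {ffun m.-tuple 'I_n -> 'S_n},
    N = [set g | forall m, H m (level m g)].

(* Main.v *)
Require Import Defs.
From mathcomp Require Import all_boot all_fingroup all_solvable.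
From mathcomp Require Import boolp classical_sets.

Set Implicit Arguments.
Unset Strict Implicit.
Unset Printing Implicit Defensive.

Import GroupScope.
Local Open Scope group_scope.
Local Open Scope classical_set_scope.

(** Write sgn_m(g) for the product of the signs of the vertex permutations of g
    at depth m.  Since g permutes the vertices of depth m, sgn_m is a
    homomorphism from W onto a group of order two; its kernel is
    [W_tilde n m.+1], which is therefore maximal normal, and visibly levelwise.

    Conversely let N be maximal normal and levelwise.  As N is a proper product
    of level factors, there is a first depth m at which N does not realize every
    labelling.  Being levelwise, N contains every element supported above depth
    m, and contains with g its restriction to depth m.  The elements supported
    above depth m act transitively on the vertices of depth m, so conjugation by
    them shows that, modulo N, a permutation placed at one vertex of depth m may
    be moved to any other ([restr_cong]): each element supported at depth m is
    congruent to the product of its labels, placed at a single fixed vertex u.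
    The permutations s such that s placed at u lies in N form a normal subgroup
    of 'S_n.  If N contained g with sgn_m(g) = -1, this subgroup would contain an
    odd permutation, so it would be all of 'S_n ([odd_normal_Sym]), and N would
    contain every element supported at depth m, contrary to the choice of m
    ([odd_restr_full]).  Hence N lies in the kernel of sgn_m, and equals it by
    maximality.

    A normal subgroup G of Sym(T) with an odd element s is all of Sym(T): modulo
    G, a transposition (i j) is congruent to its conjugate (s i  s j).  This
    yields two distinct congruent transpositions sharing a point; by conjugation
    all transpositions are congruent, so G has index at most two, and the odd
    element s forces G to be everything. *)

(** * Normal subgroups of the symmetric group *)

(** Three transpositions put i, j and k in place in turn, each fixing the points
    already placed. *)
Lemma perm_move3 (T : finType) (i j k a b c : T) :
  uniq [:: i; j; k] -> uniq [:: a; b; c] ->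
  exists x : {perm T}, [/\ x i = a, x j = b & x k = c].
Proof.
rewrite /= !inE !negb_or !andbT => /andP[/andP[ij ik] jk] /andP[/andP[ab ac] bc].
set x1 := tperm i a.
have aj : a != x1 j by rewrite -(tpermL i a) (inj_eq perm_inj).
set x2 := x1 * tperm (x1 j) b.
have x2i : x2 i = a by rewrite permM tpermL tpermD // eq_sym.
have x2j : x2 j = b by rewrite permM tpermL.
have ak : a != x2 k by rewrite -x2i (inj_eq perm_inj).
have bk : b != x2 k by rewrite -x2j (inj_eq perm_inj).
exists (x2 * tperm (x2 k) c); rewrite !(permM x2) x2i x2j tpermL.
by split=> //; rewrite tpermD // eq_sym.
Qed.

Section NormalSubgroupsOfSym.
Variables (T : finType) (G : {group {perm T}}).
Hypothesis nG : [set: {perm T}]%SET \subset 'N(G).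

Let memGJ s x : (s ^ x \in G) = (s \in G).
Proof. by rewrite memJ_norm // (fintype.subsetP nG) ?inE. Qed.

(** The product is the commutator of [tperm i j] and s. *)
Lemma tperm_commG s i j : s \in G -> tperm i j * tperm (s i) (s j) \in G.
Proof.
move=> Gs; rewrite -tpermJ conjgE !mulgA groupMr //.
by rewrite -{1}(tpermV i j) -mulgA -conjgE memGJ groupV.
Qed.

(** Modulo G, if two distinct transpositions with a common point are congruent,
    then by conjugation so are all such pairs; any two transpositions are joined
    by a chain [(a b)], [(a c)], [(c d)] of these. *)
Lemma tpermM_in_normal i j k : uniq [:: i; j; k] ->
  tperm i j * tperm i k \in G ->
  forall a b c d, a != b -> c != d -> tperm a b * tperm c d \in G.
Proof.
move=> Uijk Gijk.
have G3 a b c : a != b -> a != c -> tperm a b * tperm a c \in G.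
  move=> ab ac; have [->|bc] := eqVneq b c; first by rewrite tperm2 group1.
  have Uabc : uniq [:: a; b; c] by rewrite /= !inE negb_or ab ac bc.
  have [x [<- <- <-]] := perm_move3 Uijk Uabc.
  by rewrite -!tpermJ -conjMg memGJ.
move=> a b c d ab cd; have [eca|ca] := eqVneq c a; last first.
  have -> : tperm a b * tperm c d = tperm a b * tperm a c * (tperm c a * tperm c d).
    by rewrite mulgA -(mulgA (tperm a b)) (tpermC c a) tperm2 mulg1.
  by rewrite groupM ?G3 // eq_sym.
by rewrite eca in cd *; apply: G3.
Qed.

Hypothesis T3 : 2 < #|T|.

Let third (i j : T) : exists k, (k != i) && (k != j).
Proof.
have : 0 < #|~: [set i; j]%SET|.
  by rewrite cardsCs finset.setCK cards2 subn_gt0; apply: leq_ltn_trans T3; case: (i != j).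
by move=> /card_gt0P[k]; rewrite !inE negb_or => kij; exists k.
Qed.

(** If s is not an involution, or if it fixes a point, take [(i j)] adjacent to
    its conjugate by s.  Otherwise s is an involution without fixed points, and
    two of its cycles give [(i j)] congruent to [(s i  s j)], with four distinct
    points.  Being odd, s has a further point e, and conjugation by [(s j  e)]
    makes [(i j)] also congruent to [(s i  e)]. *)
Lemma odd_normal_tperm2 s : s \in G -> odd_perm s ->
  exists i j k, uniq [:: i; j; k] /\ tperm i j * tperm i k \in G.
Proof.
move=> Gs odds; have Gc i j := tperm_commG i j Gs.
have sI i j : (s i == s j) = (i == j) by rewrite (inj_eq perm_inj).
have [[i sii ssi]|invs] := pselect (exists2 i, s i != i & s (s i) != i).
  exists (s i), i, (s (s i)); split; last by rewrite (tpermC (s i) i).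
  by rewrite /= !inE !negb_or sii eq_sym sI sii eq_sym ssi.
have {}invs i : s (s i) = i.
  have [sii|sii] := eqVneq (s i) i; first by rewrite !sii.
  by apply/eqP/negPn/negP => ssi; apply: invs; exists i.
have neq_perm (u : {perm T}) : ~~ odd_perm u -> exists i, s i != u i.
  move=> evu; apply/existsP; rewrite -negb_forall; apply: contra evu => /forallP su.
  by have <- : s = u by apply/permP=> i; apply/eqP.
have [i sii] : exists i, s i != i.
  by have [|i] := neq_perm 1; [rewrite odd_perm1 | rewrite perm1 => sii; exists i].
have [j /andP[ji jsi]] := third i (s i).
have [sjj|sjj] := eqVneq (s j) j.
  exists j, i, (s i); split; last by have := Gc j i; rewrite sjj.
  by rewrite /= !inE !negb_or ji jsi eq_sym sii.
have sji : s j != i by rewrite -(invs i) sI.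
have sij : s i != s j by rewrite sI eq_sym.
have [|e] := neq_perm (tperm i (s i) * tperm j (s j)).
  by rewrite odd_mul_tperm odd_tperm !(eq_sym _ (s _)) sii sjj.
rewrite permM => ne_e.
have ei : e != i.
  by apply: contraNneq ne_e => ->; rewrite tpermL tpermD // eq_sym.
have esi : e != s i.
  by apply: contraNneq ne_e => ->; rewrite tpermR tpermD ?invs.
have ej : e != j.
  by apply: contraNneq ne_e => ->; rewrite (tpermD (x := i)) ?tpermL // eq_sym.
have esj : e != s j.
  apply: contraNneq ne_e => ->.
  by rewrite (tpermD (x := i)) ?tpermR ?invs // eq_sym.
exists (s i), (s j), e; split.
  by rewrite /= !inE !negb_or sij (eq_sym _ e) esi (eq_sym _ e) esj.
have Gije : tperm i j * tperm (s i) e \in G.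
  rewrite -[X in X \in G](_ : (tperm i j * tperm (s i) (s j)) ^ tperm (s j) e = _).
    by rewrite memGJ.
  rewrite conjMg !tpermJ tpermL !tpermD // 1?eq_sym //.
have := groupM (groupVr (Gc i j)) Gije.
by rewrite invMg !tpermV mulgA -(mulgA (tperm _ _) (tperm i j)) tperm2 mulg1.
Qed.

Lemma odd_normal_Sym s : s \in G -> odd_perm s -> forall x, x \in G.
Proof.
move=> Gs odds; have [i [j [k [Uijk Gijk]]]] := odd_normal_tperm2 Gs odds.
have Gtt := tpermM_in_normal Uijk Gijk.
have ij : i != j by case/andP: Uijk; rewrite inE negb_or => /andP[].
set t := tperm i j; have tt : t * t = 1 by rewrite tperm2.
(* Each transposition is t modulo G, so x is a power of t given by its parity. *)
have Gx x : x * t ^+ odd_perm x \in G.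
  have [ts -> dts] := prod_tpermP x.
  elim: ts dts => [_|u ts IHts /= /andP[du /IHts{IHts}]].
    by rewrite big_nil odd_perm1 mulg1.
  rewrite big_cons odd_mul_tperm; move: du; rewrite /dpair /= => du.
  rewrite du; set w := \prod_(_ <- _) _; set p := odd_perm w => Gw.
  have Gut : tperm u.1 u.2 * t \in G by apply: Gtt.
  rewrite -(memGJ _ (tperm u.1 u.2)) conjgE in Gw.
  have tpt : t ^+ p * t = t ^+ ~~ p by case: (p); rewrite // mul1g.
  have := groupM Gw Gut; rewrite tpermV -!mulgA (mulgA _ _ t) tperm2 mul1g.
  by rewrite tpt.
have Gt : t \in G by have := Gx s; rewrite odds groupMl.
by move=> x; have := Gx x; rewrite groupMr // groupX.
Qed.
End NormalSubgroupsOfSym.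

(** * Subgroups of index two *)

Lemma index2_maximal_normal (G : groupType) (f : G -> bool) :
  {morph f : x y / x * y >-> x (+) y} -> (exists x, f x) ->
  maximal_normal_subgroup [set x | ~~ f x].
Proof.
move=> fM [x0 fx0].
have f1 : f 1 = false by have := fM 1 1; rewrite mul1g; case: (f 1).
have fV x : f x^-1 = f x.
  by have := fM x x^-1; rewrite mulgV f1; case: (f x); case: (f _).
split.
- split=> [|x y|x|x y] /=; rewrite ?f1 ?fV ?conjgE ?fM ?fV //.
    by move=> /negPf-> /negPf->.
  by move=> /negPf->; rewrite addbb.
- by move=> /seteqP[_ /(_ x0 Logic.I)]; rewrite /= fx0.
move=> M [M1 MM MV MJ] sNM.
have [[x Mx fx]|evM] := pselect (exists2 x, M x & f x); last first.
  left; apply/seteqP; split=> // x Mx /=; apply/negP => fx.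
  by apply: evM; exists x.
right; apply/seteqP; split=> // y _.
have [fy|fy] := boolP (f y); last exact: sNM.
rewrite -(mulgKV x y); apply: MM => //; apply: sNM.
by rewrite /= fM fV fx fy.
Qed.

(** * Elements supported at one level of the tree *)

Section Tree.
Variable n : nat.
Implicit Types (g h x y : W n) (u v w : seq 'I_n) (s t : 'S_n).

Lemma W_mulE g h v : (g * h) v = g v * h (tree_act g v).
Proof. by []. Qed.

Lemma size_tree_act g v : size (tree_act g v) = size v.
Proof. by elim: v g => //= i v IHv g; rewrite IHv. Qed.

Lemma tree_act_inj g : injective (tree_act g).
Proof. exact: can_inj (tree_actK g). Qed.

Lemma tree_act_fix g v :
  (forall w, size w < size v -> g w = 1) -> tree_act g v = v.
Proof.
elim/last_ind: v => //= v i IHv gv; rewrite tree_act_rcons gv ?size_rcons //.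
by rewrite perm1 IHv // => w vw; apply: gv; rewrite size_rcons ltnW.
Qed.

(** The tree automorphism may be chosen trivial at the depth of u and below; the
    transitivity of W on each level is thus realized by elements that lie in
    every levelwise normal subgroup with full factors above that level. *)
Lemma tree_trans u v : size u = size v ->
  exists a : W n, (forall w, size u <= size w -> a w = 1) /\ tree_act a u = v.
Proof.
elim: u v => [|i u IHu] [|j v] //= => [_|[/IHu[a [a1 auv]]]].
  by exists 1.
exists (fun w => if w is _ :: w' then a w' else tperm i j); split.
  by case=> //= _ w; apply: a1.
by rewrite /= tpermL auv.
Qed.

Definition restr m g : W n := fun v => if size v == m then g v else 1.

Definition node u s : W n := fun v => if v == u then s else 1.

Definition spread (r : seq (seq 'I_n)) g : W n :=
  fun v => if v \in r then g v else 1.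

(** A factor supported at depth m moves no vertex of depth at most m, so the
    twist in the product of W disappears. *)
Lemma level_mul m g h :
  (forall v, size v != m -> g v = 1) -> (forall v, size v != m -> h v = 1) ->
  g * h = (fun v => g v * h v) :> W n.
Proof.
move=> g1 h1; apply/funext => v; rewrite W_mulE.
have [lev|ltv] := leqP (size v) m.
  by rewrite tree_act_fix // => w wv; rewrite g1 // neq_ltn (leq_trans wv).
by rewrite !h1 // ?size_tree_act neq_ltn ltv orbT.
Qed.

Lemma node_level u s v : size v != size u -> node u s v = 1.
Proof. by rewrite /node; have [->|//] := eqVneq v u; rewrite eqxx. Qed.

Lemma nodeM u s t : node u (s * t) = node u s * node u t.
Proof.
rewrite (level_mul (@node_level u s) (@node_level u t)).
by apply/funext => v; rewrite /node; case: eqP; rewrite ?mulg1.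
Qed.

Lemma node1 u : node u 1 = 1.
Proof. by apply/funext => v; rewrite /node; case: eqP. Qed.

Lemma nodeV u s : node u s^-1 = (node u s)^-1.
Proof. by apply: (mulgI (node u s)); rewrite -nodeM !mulgV node1. Qed.

Lemma nodeJ u s t : node u (s ^ t) = node u s ^ node u t.
Proof. by rewrite !conjgE !nodeM nodeV. Qed.

(** The induction step that turns [restr m g], which is [spread (verts m) g], into
    a product of single labels. *)
Lemma spread_cons v r g : {in v :: r, forall w, size w = size v} -> uniq (v :: r) ->
  spread (v :: r) g = node v (g v) * spread r g.
Proof.
move=> sz /andP[vr _]; rewrite (@level_mul (size v)) => [|w|w].
- apply/funext => w; rewrite /spread /node inE.
  by have [->|] := eqVneq; rewrite ?mul1g // (negPf vr) mulg1.
- exact: node_level.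
rewrite /spread; case: ifP => // wr; rewrite sz ?eqxx //.
by rewrite inE wr orbT.
Qed.

Definition verts m : seq (seq 'I_n) := map val (enum {: m.-tuple 'I_n}).

Lemma mem_verts m v : (v \in verts m) = (size v == m).
Proof.
apply/mapP/eqP => [[t _ ->]|sv]; first exact: size_tuple.
by exists (tcast sv (in_tuple v)); rewrite ?mem_enum //= val_tcast.
Qed.

Lemma uniq_verts m : uniq (verts m).
Proof. by rewrite map_inj_uniq ?enum_uniq //; apply: val_inj. Qed.

Lemma spread_verts m g : spread (verts m) g = restr m g.
Proof. by apply/funext => v; rewrite /spread mem_verts. Qed.

(** * The sign at a level *)

(** The order of the factors does not matter, as only the parity of the product
    is kept. *)
Definition level_sgn m g := odd_perm (\prod_(v <- verts m) g v).

Lemma odd_perm_prod_seq I (r : seq I) (F : I -> 'S_n) :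
  odd_perm (\prod_(i <- r) F i) = \big[addb/false]_(i <- r) odd_perm (F i).
Proof. by apply: (big_morph _ (@odd_permM _)); rewrite odd_perm1. Qed.

(** The twist by the action of g only permutes the vertices of depth m. *)
Lemma level_sgnM m : {morph level_sgn m : g h / g * h >-> g (+) h}.
Proof.
move=> g h; rewrite /level_sgn !odd_perm_prod_seq.
under eq_bigr do rewrite W_mulE odd_permM.
rewrite big_split /=; congr (_ (+) _).
rewrite -(big_map (tree_act g) xpredT (fun v => odd_perm (h v))).
apply: perm_big; apply: uniq_perm; rewrite ?uniq_verts //.
  by rewrite (map_inj_uniq (@tree_act_inj g)) uniq_verts.
move=> v; rewrite mem_verts; apply/mapP/eqP => [[w + ->]|vm].
  by rewrite mem_verts size_tree_act => /eqP.
by exists (tree_actV g v); rewrite ?tree_actVK // mem_verts -(size_tree_act g) tree_actVK vm.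
Qed.

Lemma odd_dec s : odd (dec s) = odd_perm s.
Proof.
have le_n : #|porbits s| <= n.
  by rewrite -[leqRHS]card_ord; apply: leq_imset_card.
by rewrite /dec oddB // /odd_perm card_ord.
Qed.

Lemma W_tildeE k : @W_tilde n k = [set g | ~~ level_sgn k.-1 g].
Proof.
rewrite /W_tilde; congr mkset; apply/funext => g; congr (is_true (~~ _)).
rewrite /level_sgn odd_perm_prod_seq big_map big_enum (big_morph odd oddD (erefl _)).
by apply: eq_bigr => v _; rewrite odd_dec.
Qed.

Lemma W_tilde1E : @W_tilde1 n = @W_tilde n 1.
Proof.
rewrite W_tildeE /W_tilde1; congr mkset; apply/funext => g.
rewrite Alt_even /level_sgn (_ : verts 0 = [:: [::]]) ?big_seq1 //.
apply: perm_small_eq => //; apply: uniq_perm; rewrite ?uniq_verts // => v.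
by rewrite mem_verts inE size_eq0.
Qed.

(** * Levelwise normal subgroups *)

Definition full (N : set (W n)) m :=
  forall g, exists2 x, N x & forall v, size v = m -> x v = g v.

(** Form in which the levelwise hypothesis is used: an element that can be
    matched by N at each level separately lies in N. *)
Lemma levelwise_mem (N : set (W n)) g : levelwise N ->
  (forall m, exists2 x, N x & forall v, size v = m -> x v = g v) -> N g.
Proof.
case=> H -> Hg m; have [x /(_ m) Hx xg] := Hg m.
rewrite (_ : level m g = level m x) //.
by apply/ffunP=> v; rewrite !ffunE xg ?size_tuple.
Qed.

(** As a is trivial at the depth of u, conjugation by a moves the label without
    conjugating it. *)
Lemma node_conj u s (a : W n) : (forall w, size u <= size w -> a w = 1) ->
  node u s ^ a = node (tree_act a u) s.
Proof.
move=> a1; apply: (mulgI a); rewrite -conjgC; apply/funext => v.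
rewrite !W_mulE /node (inj_eq (@tree_act_inj a)).
have [->|vu] := eqVneq v u; first by rewrite !a1 ?mulg1 ?mul1g // size_tree_act.
have [uv|vltu] := leqP (size u) (size v).
  by rewrite !a1 ?mulg1 // size_tree_act.
rewrite mul1g mulg1 -/(node u s) tree_act_fix // => w wv.
by rewrite node_level // neq_ltn (ltn_trans wv).
Qed.

(** The condition [N (x^-1 * x')] stands for equality of x and x' in the quotient
    of W by N. *)
Lemma normal_cong (N : set (W n)) x x' y y' : normal_subgroup N ->
  N (x^-1 * x') -> N (y^-1 * y') -> N ((x * y)^-1 * (x' * y')).
Proof.
move=> [_ NM _ NJ] Nx Ny.
rewrite (_ : _ * _ = (y^-1 * y') * (x^-1 * x') ^ y'); first by apply/NM/NJ.
by rewrite conjgE invgM !mulgA mulgK.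
Qed.

(** Modulo N all labels at depth m can be gathered at u: by [node_conj] the
    quotient of two copies of s at different vertices is the commutator of one of
    them with an element supported above depth m, which lies in N. *)
Lemma restr_cong (N : set (W n)) m u g : normal_subgroup N ->
  (forall a : W n, (forall w, m <= size w -> a w = 1) -> N a) -> size u = m ->
  N ((restr m g)^-1 * node u (\prod_(v <- verts m) g v)).
Proof.
move=> nN Nup um; have [N1 NM NV NJ] := nN.
have node_cong v s : size v = m -> N ((node v s)^-1 * node u s).
  move=> vm; have [|a [a1 <-]] := @tree_trans v u; first by rewrite vm.
  have Na : N a by apply: Nup => w; rewrite -vm; apply: a1.
  rewrite -node_conj // conjgE !mulgA -(mulgA (node v s)^-1) -conjgE.
  by apply: NM => //; apply/NJ/NV.
rewrite -spread_verts; have := uniq_verts m.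
have : forall v, v \in verts m -> size v = m by move=> v; rewrite mem_verts => /eqP.
elim: (verts m) => [|v r IHr] szr Ur.
  by rewrite big_nil node1 mulg1 (_ : spread _ _ = 1) ?invg1.
rewrite spread_cons //; last by move=> w wr; rewrite !szr // mem_head.
rewrite big_cons nodeM; apply: normal_cong => //.
  by apply: node_cong; rewrite szr ?mem_head.
by apply: IHr => [w wr|]; [rewrite szr // inE wr orbT | case/andP: Ur].
Qed.

(** The labels s with [node u s] in N form a normal subgroup of 'S_n, which by
    [restr_cong] contains the odd product of the labels of x. *)
Lemma odd_restr_full (N : set (W n)) m x : 2 < n -> normal_subgroup N ->
  (forall a : W n, (forall w, m <= size w -> a w = 1) -> N a) ->
  N (restr m x) -> level_sgn m x -> forall g, N (restr m g).
Proof.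
move=> n3 nN Nup Nx oddx g; have [N1 NM NV NJ] := nN.
pose u := nseq m (Ordinal (ltnW (ltnW n3))).
have um : size u = m by rewrite size_nseq.
pose P := [set s | `[< N (node u s) >]]%SET.
have gP : group_set P.
  apply/group_setP; split=> [|s t]; rewrite !inE ?node1 // nodeM; exact: NM.
have nP : [set: 'S_n]%SET \subset 'N(Group gP).
  apply/fintype.subsetP => t _; rewrite inE; apply/fintype.subsetP => _ /imsetP[s + ->].
  rewrite !inE nodeJ; exact: NJ.
have Px : \prod_(v <- verts m) x v \in Group gP.
  rewrite inE -[node _ _](mulKVg (restr m x)) inE.
  by apply: NM => //; apply: restr_cong.
have T3 : 2 < #|'I_n| by rewrite card_ord.
have := odd_normal_Sym nP T3 Px oddx (\prod_(v <- verts m) g v).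
rewrite !inE => Ng; rewrite -[restr m g]invgK.
have := NM _ _ (restr_cong g nN Nup um) (NV _ Ng).
by rewrite mulgK => /NV.
Qed.

Lemma W_tilde_maximal k : 1 < n -> maximal_normal_subgroup (@W_tilde n k).
Proof.
move=> n2; rewrite W_tildeE; apply: index2_maximal_normal (@level_sgnM _) _.
pose i := Ordinal (ltnW n2); pose j := Ordinal n2.
exists (node (nseq k.-1 i) (tperm i j)).
rewrite /level_sgn odd_perm_prod_seq (bigD1_seq (nseq k.-1 i)) ?uniq_verts //=; last first.
  by rewrite mem_verts size_nseq.
rewrite big1 => [|v /negPf vi]; last by rewrite /node vi odd_perm1.
by rewrite /node eqxx odd_tperm.
Qed.

Lemma W_tilde_levelwise k : levelwise (@W_tilde n k).
Proof.
exists (fun m => [set f | m = k.-1 -> ~~ odd (\sum_v dec (f v))]).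
apply/seteqP; split=> g /= => [gev m -> {m}|/(_ _ erefl)].
  by under eq_bigr do rewrite ffunE.
by under eq_bigr do rewrite ffunE.
Qed.

(** The index m is the first level at which N is not full: minimality puts the
    elements supported above m in N, and fullness fails at m as soon as N contains
    an element odd at that level. *)
Lemma levelwise_maximal_W_tilde (N : set (W n)) : 2 < n ->
  maximal_normal_subgroup N -> levelwise N -> exists m, N = @W_tilde n m.+1.
Proof.
move=> n3 [nN NT maxN] lN; have [N1 _ _ _] := nN.
have exm : exists m, ~~ `[< full N m >].
  apply: contrapT => nfull; apply: NT; apply/seteqP; split=> // g _.
  apply: levelwise_mem => // m; have [//|fm] := pselect (full N m).
  by case: nfull; exists m; apply/asboolPn.
case: (ex_minnP exm) => m /asboolPn nfm minm; exists m.
have Nup (a : W n) : (forall w, m <= size w -> a w = 1) -> N a.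
  move=> a1; apply: levelwise_mem => // j; have [mj|jm] := leqP m j.
    by exists 1 => // v vj; rewrite a1 ?vj.
  have : `[< full N j >] by apply: contraLR jm => /minm; rewrite -leqNgt.
  by move=> /asboolP.
have Nrestr x : N x -> N (restr m x).
  move=> Nx; apply: levelwise_mem => // j; have [->|jm] := eqVneq j m.
    by exists x => // v vm; rewrite /restr vm eqxx.
  by exists 1 => // v vj; rewrite /restr vj (negPf jm).
have [nM MT maxM] := W_tilde_maximal m.+1 (ltnW n3).
have sNM : N `<=` @W_tilde n m.+1.
  rewrite W_tildeE => x Nx /=; apply/negP => oddx; apply: nfm => g.
  exists (restr m g); first exact: odd_restr_full (Nrestr x Nx) oddx _.
  by move=> v vm; rewrite /restr vm eqxx.
by have [] := maxN _ nM sNM.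
Qed.

End Tree.

(** * The maximal normal subgroups *)

Theorem proposition24 (n : nat) (hn : 3 <= n) (N : set (W n)) :
  (maximal_normal_subgroup N /\ levelwise N) <->
  (N = @W_tilde1 n \/ exists2 k : nat, 2 <= k & N = @W_tilde n k).
Proof.
rewrite W_tilde1E; split.
  move=> [maxN /(levelwise_maximal_W_tilde hn maxN)[[|m] ->]]; first by left.
  by right; exists m.+2.
move=> NE; have [k ->] : exists k, N = @W_tilde n k.
  by case: NE => [->|[k _ ->]]; [exists 1%N | exists k].
by split; [apply: W_tilde_maximal; apply: ltnW | apply: W_tilde_levelwise].
Qed.
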